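(* Let $t_0,\lambda\ge1$ and $c\ge0$, $d>0$ be such that $$\max\left\{\lambda(c+d)^{\lambda-1},\frac{(c+d)^{\lambda}}{d}\right\}\cdot\int_{t_0}^{+\infty}t^{\lambda}q(t)\,dt<1,$$ where the function $q:[t_0,+\infty)\to[0,+\infty)$ is continuous and its zeros (if any) are isolated. Then the equation $$x''+q(t)x^{\lambda}=0,\qquad t\ge t_0,$$ possesses a solution $x(t)$ defined in $[t_0,+\infty)$ with the property that $$c-d\le x'(t)<\frac{x(t)}{t}\le c+d,\qquad t>t_0,$$ and with the asymptotic profile $x(t)=ct+o(t)$ as $t\to+\infty$.
   Context: For real $x$, $x^{\lambda}$ means $|x|^{\lambda-1}x$. *)

(* Defs.v *)
From Stdlib Require Import Reals.
From Coquelicot Require Import Coquelicot.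
Open Scope R_scope.

(* The half-line [t0, +oo).  Functions on it are total functions on R whose
   values below t0 play no role: continuity and derivatives are taken relative
   to the half-line ([continue_in], [D_in]), hence one-sidedly at t0. *)
Definition half_line (t0 t : R) : Prop := t0 <= t.

(* x^lambda := |x|^(lambda - 1) x for real x.  [Rpower 0 a] is 1 rather than 0
   for a > 0, which is harmless: the factor x makes the value at x = 0 equal
   to 0.  For x > 0 this is [Rpower x lambda]. *)
Definition signed_pow (x lambda : R) : R := Rpower (Rabs x) (lambda - 1) * x.

Definition isolated_zeros (q : R -> R) (D : R -> Prop) : Prop :=
  forall t : R, D t -> q t = 0 ->
    exists eps : R, 0 < eps /\
      forall s : R, D s -> s <> t -> Rabs (s - t) < eps -> q s <> 0.

(* [x1] and [x2] are the first and second derivatives of [x] on [t0, +oo). *)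
Definition is_solution (q : R -> R) (lambda t0 : R) (x x1 x2 : R -> R) : Prop :=
  forall t : R, half_line t0 t ->
    D_in x x1 (half_line t0) t /\
    D_in x1 x2 (half_line t0) t /\
    x2 t + q t * signed_pow (x t) lambda = 0.

(* Main.v *)
Require Import Defs.
From Stdlib Require Import Reals.
From Coquelicot Require Import Coquelicot.
From Stdlib Require Import Lra Lia.
Open Scope R_scope.

(** Put [g s = q s * x s ^ lambda].  The solutions of [x'' = - g] with slope
    [c] at infinity are, with an arbitrary constant [k],
      [x t = k + c t + int_t0^oo (min s t) g s ds],   [x' t = c + int_t^oo g].
    For any such [x] and [g >= 0], [k > 0], the required estimates on [x'] can
    be read off: [x' >= c], and
      [x t - t x' t = k + int_t0^t s g s ds > 0].
    Moreover [(x t - c t)' = int_t^oo g] tends to [0], so [x t = c t + o(t)].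

    To find [x], write [x t = t v t].  The unknown slope [v] is a fixed point of
      [T v t = c + k / t + int_t0^oo (min s t / t) w s (v s) ^ lambda ds],
    where [w s = s ^ lambda q s] and [J] is its integral.  Since
    [min s t / t <= 1], if [c + k / t <= v <= c + d] then
      [c + k / t <= T v t <= c + k / t0 + (c + d) ^ lambda J],
    and [T] is Lipschitz in the uniform norm with constant
    [lambda (c + d) ^ (lambda - 1) J].  Of the two bounds contained in the
    smallness condition, one makes [T] a contraction and the other,
    [(c + d) ^ lambda J < d], leaves room for
      [k = t0 (d - (c + d) ^ lambda J) > 0],
    with which [T v <= c + d].  A positive [k] is what makes [x' < x / t]
    strict and excludes the zero solution, which is the fixed point of [T]
    when [c = k = 0]; it also keeps [v] positive, so that only powers of
    positive numbers occur.

    The fixed point comes from [contraction_fixed_point]; the integral operator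
    is [green], whose positivity and linearity yield all its estimates; the
    equation for [v] is solved in [slope_equation_solution]. *)

(** * A contraction principle for continuous functions *)

(** Iterate [T] from [lo].  Since any two functions of the class differ by at
    most [D], the iterates [u (n + m)] and [u n] differ by at most
    [D * kappa ^ n], so they converge uniformly and the limit stays in the
    class. *)
Lemma contraction_fixed_point (lo hi : R -> R) (D kappa : R)
  (T : (R -> R) -> R -> R)
  (inC := fun f : R -> R =>
     (forall t, continuous f t) /\ forall t, lo t <= f t <= hi t) :
  (forall t, continuous lo t) -> (forall t, lo t <= hi t <= lo t + D) ->
  0 <= kappa < 1 ->
  (forall f, inC f -> inC (T f)) ->
  (forall f g delta, inC f -> inC g -> 0 <= delta ->
     (forall t, Rabs (f t - g t) <= delta) ->
     forall t, Rabs (T f t - T g t) <= kappa * delta) ->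
  exists f, inC f /\ forall t, T f t = f t.
Proof.
  intros Clo Hhi Hk HT Hlip.
  assert (D0 : 0 <= D) by (specialize (Hhi 0); lra).
  pose (u := fix u (n : nat) : R -> R :=
               match n with O => lo | S m => T (u m) end).
  assert (Hu : forall n, inC (u n)).
  { induction n as [|n IH].
    - split; [exact Clo | intros t; simpl; specialize (Hhi t); lra].
    - apply HT, IH. }
  assert (Hcau : forall n m t, Rabs (u (n + m)%nat t - u n t) <= D * kappa ^ n).
  { induction n as [|n IH]; intros m t.
    - simpl. destruct (Hu m) as [_ H]. specialize (H t). specialize (Hhi t).
      apply Rabs_le. lra.
    - simpl. replace (D * (kappa * kappa ^ n)) with (kappa * (D * kappa ^ n)) by ring.
      apply Hlip; auto.
      apply Rmult_le_pos; [exact D0 | apply pow_le; lra]. }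
  assert (Hgeo : is_lim_seq (fun n => D * kappa ^ n) 0).
  { replace (Finite 0) with (Rbar_mult D 0) by (simpl; f_equal; ring).
    apply is_lim_seq_scal_l, is_lim_seq_geom. rewrite Rabs_pos_eq; lra. }
  assert (Hsmall : forall eps : posreal, exists N, D * kappa ^ N < eps).
  { intros eps. apply is_lim_seq_spec in Hgeo. destruct (Hgeo eps) as [N HN].
    exists N. specialize (HN N (Nat.le_refl _)).
    apply Rabs_def2 in HN. lra. }
  assert (Hlim : forall t, exists l : R, is_lim_seq (fun n => u n t) l).
  { intros t. apply ex_lim_seq_cauchy_corr. intros eps.
    destruct (Hsmall (pos_div_2 eps)) as [N HN]. simpl in HN. exists N.
    intros n m Hn Hm.
    replace n with (N + (n - N))%nat by lia.
    replace m with (N + (m - N))%nat by lia.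
    assert (H1 := Hcau N (n - N)%nat t). assert (H2 := Hcau N (m - N)%nat t).
    apply Rabs_le_between in H1, H2.
    apply Rabs_def1; lra. }
  pose (f := fun t => real (Lim_seq (fun n => u n t))).
  assert (Hf : forall t, is_lim_seq (fun n => u n t) (f t)).
  { intros t. destruct (Hlim t) as [l Hl]. unfold f.
    rewrite (is_lim_seq_unique _ _ Hl). exact Hl. }
  assert (Hfu : forall n t, Rabs (f t - u n t) <= D * kappa ^ n).
  { intros n t.
    refine (is_lim_seq_le (fun m => Rabs (u (n + m)%nat t - u n t))
             (fun _ => D * kappa ^ n) (Rabs (f t - u n t)) (D * kappa ^ n) _ _ _).
    - intros m; apply Hcau.
    - apply (is_lim_seq_abs _ (Finite (f t - u n t))).
      apply is_lim_seq_minus'; [| apply is_lim_seq_const].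
      apply (is_lim_seq_ext (fun m => u (m + n)%nat t)).
      + intros m; f_equal; lia.
      + apply (is_lim_seq_incr_n (fun m => u m t)), Hf.
    - apply is_lim_seq_const. }
  assert (Cf : inC f).
  { split.
    - intros t. apply filterlim_locally. intros eps.
      destruct (Hsmall (mkposreal (eps / 3) ltac:(destruct eps; simpl; lra))) as [N HN].
      simpl in HN.
      (* Three-epsilon argument: [u N] is continuous and uniformly close to [f]. *)
      destruct (Hu N) as [Cu _]. specialize (Cu t).
      apply filterlim_locally with (eps := mkposreal (eps / 3) ltac:(destruct eps; simpl; lra)) in Cu.
      revert Cu. apply filter_imp. intros s Hs.
      change (Rabs (u N s - u N t) < eps / 3) in Hs.
      change (Rabs (f s - f t) < eps).
      assert (H1 := Hfu N s). assert (H2 := Hfu N t).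
      apply Rabs_le_between in H1, H2. apply Rabs_def2 in Hs.
      apply Rabs_def1; lra.
    - intros t. split.
      + refine (is_lim_seq_le (fun _ => lo t) (fun n => u n t) (lo t) (f t) _ _ (Hf t)).
        * intros n; apply (Hu n).
        * apply is_lim_seq_const.
      + refine (is_lim_seq_le (fun n => u n t) (fun _ => hi t) (f t) (hi t) _ (Hf t) _).
        * intros n; apply (Hu n).
        * apply is_lim_seq_const. }
  exists f. split; [exact Cf |]. intros t.
  apply Rminus_diag_uniq.
  apply Rabs_eq_0. apply Rle_antisym; [| apply Rabs_pos].
  apply le_epsilon. intros eps Heps.
  destruct (Hsmall (mkposreal (eps / 2) ltac:(lra))) as [N HN]. simpl in HN.
  assert (P : 0 <= D * kappa ^ N) by (apply Rmult_le_pos; [exact D0 | apply pow_le; lra]).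
  (* Both [T f] and [f] are close to [u (S N) = T (u N)]. *)
  assert (H1 := Hlip f (u N) _ Cf (Hu N) P (Hfu N) t).
  assert (H2 := Hfu (S N) t). simpl in H2.
  apply Rabs_le_between in H1, H2.
  assert (kappa * (D * kappa ^ N) <= 1 * (D * kappa ^ N)) by (apply Rmult_le_compat_r; lra).
  apply Rabs_le. lra.
Qed.

(** * The Green operator of the second derivative on a half-line *)

Lemma ex_RInt_continuous_all (g : R -> R) (a b : R) :
  (forall t, continuous g t) -> ex_RInt g a b.
Proof.
  intros H. apply (ex_RInt_continuous (V := R_CompleteNormedModule)).
  intros; apply H.
Qed.

Lemma is_RInt_continuous (g : R -> R) (a b : R) :
  (forall t, continuous g t) -> is_RInt g a b (RInt g a b).
Proof.
  intros H. apply (RInt_correct (V := R_CompleteNormedModule)).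
  apply ex_RInt_continuous_all, H.
Qed.

Lemma continuous_id_mult (g : R -> R) :
  (forall t, continuous g t) -> forall t, continuous (fun s => s * g s) t.
Proof.
  intros H t. apply (continuous_mult (fun s : R => s) g); [apply continuous_id | apply H].
Qed.

(** The improper integral, taken along the sequence [a + n]; for the
    nonnegative functions below this determines the limit. *)
Definition integral_from (a : R) (g : R -> R) : R :=
  real (Lim_seq (fun n => RInt g a (a + INR n))).

Definition integrable_from (a : R) (g : R -> R) : Prop :=
  (forall t, continuous g t) /\
  is_lim_seq (fun n => RInt g a (a + INR n)) (integral_from a g).

(** [int_t^oo g], in a form that is differentiable in [t] at sight. *)
Definition tail (a : R) (g : R -> R) (t : R) : R := integral_from a g - RInt g a t.

(** [int_a^oo (min s t) g s ds], that is, a solution of [- y'' = g] with slope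
    tending to [0] at infinity. *)
Definition green (a : R) (g : R -> R) (t : R) : R :=
  RInt (fun s => s * g s) a t + t * tail a g t.

Lemma RInt_monotone (g : R -> R) (a b e : R) :
  (forall t, continuous g t) -> (forall t, 0 <= g t) -> b <= e ->
  RInt g a b <= RInt g a e.
Proof.
  intros Cg Pg Hbe.
  rewrite <- (RInt_Chasles g a b e) by (apply ex_RInt_continuous_all, Cg).
  assert (0 <= RInt g b e).
  { apply RInt_ge_0; auto. apply ex_RInt_continuous_all, Cg. }
  change (RInt g a b <= RInt g a b + RInt g b e). lra.
Qed.

Lemma integrable_from_bounded (a B : R) (g : R -> R) :
  (forall t, continuous g t) -> (forall t, 0 <= g t) ->
  (forall t, a <= t -> RInt g a t <= B) ->
  integrable_from a g /\ integral_from a g <= B.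
Proof.
  intros Cg Pg HB.
  assert (Hinc : forall n, RInt g a (a + INR n) <= RInt g a (a + INR (S n))).
  { intros n. apply RInt_monotone; auto. rewrite S_INR; lra. }
  assert (Hle : forall n, RInt g a (a + INR n) <= B).
  { intros n. apply HB. pose proof (pos_INR n); lra. }
  destruct (ex_finite_lim_seq_incr _ B Hinc Hle) as [l Hl].
  assert (E : integral_from a g = l).
  { unfold integral_from. rewrite (is_lim_seq_unique _ _ Hl). reflexivity. }
  split.
  - split; [exact Cg | rewrite E; exact Hl].
  - rewrite E.
    exact (is_lim_seq_le _ (fun _ => B) l B Hle Hl (is_lim_seq_const B)).
Qed.

Lemma integrable_from_lin (a m : R) (f g : R -> R) :
  integrable_from a f -> integrable_from a g ->
  integrable_from a (fun s => f s + m * g s) /\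
  integral_from a (fun s => f s + m * g s) = integral_from a f + m * integral_from a g.
Proof.
  intros [Cf Lf] [Cg Lg].
  assert (L : is_lim_seq (fun n => RInt (fun s => f s + m * g s) a (a + INR n))
                (integral_from a f + m * integral_from a g)).
  { apply (is_lim_seq_ext (fun n => RInt f a (a + INR n) + m * RInt g a (a + INR n))).
    - intros n. symmetry. apply is_RInt_unique.
      apply (is_RInt_plus (V := R_NormedModule)).
      + apply is_RInt_continuous, Cf.
      + apply (is_RInt_scal (V := R_NormedModule)).
        apply is_RInt_continuous, Cg.
    - apply is_lim_seq_plus'; [exact Lf |].
      apply (is_lim_seq_scal_l _ m (Finite _) Lg). }
  assert (E : integral_from a (fun s => f s + m * g s)
              = integral_from a f + m * integral_from a g).
  { unfold integral_from at 1. rewrite (is_lim_seq_unique _ _ L). reflexivity. }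
  split; [| exact E]. split; [| rewrite E; exact L].
  intros t. apply (continuous_plus (V := R_NormedModule) f); [apply Cf |].
  apply (continuous_mult (fun _ : R => m) g); [apply continuous_const | apply Cg].
Qed.

Lemma green_lin (a m t : R) (f g : R -> R) :
  integrable_from a f -> integrable_from a g ->
  green a (fun s => f s + m * g s) t = green a f t + m * green a g t.
Proof.
  intros If Ig. unfold green, tail.
  destruct (integrable_from_lin a m f g If Ig) as [_ E]. rewrite E.
  destruct If as [Cf _], Ig as [Cg _].
  assert (E1 : RInt (fun s => f s + m * g s) a t = RInt f a t + m * RInt g a t).
  { apply is_RInt_unique. apply (is_RInt_plus (V := R_NormedModule)).
    - apply is_RInt_continuous, Cf.
    - apply (is_RInt_scal (V := R_NormedModule)).
      apply is_RInt_continuous, Cg. }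
  assert (E2 : RInt (fun s => s * (f s + m * g s)) a t
               = RInt (fun s => s * f s) a t + m * RInt (fun s => s * g s) a t).
  { apply is_RInt_unique.
    apply (is_RInt_ext (fun s => s * f s + m * (s * g s))).
    { intros s _. change (s * f s + m * (s * g s) = s * (f s + m * g s)). ring. }
    apply (is_RInt_plus (V := R_NormedModule)).
    - apply is_RInt_continuous, continuous_id_mult, Cf.
    - apply (is_RInt_scal (V := R_NormedModule)).
      apply is_RInt_continuous, continuous_id_mult, Cg. }
  rewrite E1, E2. ring.
Qed.

Lemma tail_nonneg (a t : R) (g : R -> R) :
  integrable_from a g -> (forall s, 0 <= g s) -> 0 <= tail a g t.
Proof.
  intros [Cg Lg] Pg. unfold tail.
  assert (H : Rbar_le (RInt g a t) (integral_from a g)).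
  { apply (is_lim_seq_le_loc (fun _ => RInt g a t) (fun n => RInt g a (a + INR n)));
      [| apply is_lim_seq_const | exact Lg].
    destruct (INR_unbounded (t - a)) as [N HN]. exists N. intros n Hn.
    apply RInt_monotone; auto. apply le_INR in Hn. lra. }
  simpl in H. lra.
Qed.

Lemma tail_small (a eps : R) (g : R -> R) :
  integrable_from a g -> 0 < eps -> exists N, a <= N /\ tail a g N < eps.
Proof.
  intros [_ Lg] Heps. apply is_lim_seq_spec in Lg.
  destruct (Lg (mkposreal eps Heps)) as [n Hn].
  exists (a + INR n). split; [pose proof (pos_INR n); lra |].
  specialize (Hn n (Nat.le_refl _)). simpl in Hn. apply Rabs_def2 in Hn.
  unfold tail. lra.
Qed.

Lemma moment_nonneg (a t : R) (g : R -> R) :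
  0 <= a <= t -> (forall s, continuous g s) -> (forall s, 0 <= g s) ->
  0 <= RInt (fun s => s * g s) a t.
Proof.
  intros H Cg Pg. apply RInt_ge_0; [lra | |].
  - apply ex_RInt_continuous_all, continuous_id_mult, Cg.
  - intros s Hs. apply Rmult_le_pos; [lra | apply Pg].
Qed.

Lemma green_nonneg (a t : R) (g : R -> R) :
  0 <= a <= t -> integrable_from a g -> (forall s, 0 <= g s) -> 0 <= green a g t.
Proof.
  intros H Ig Pg. unfold green.
  assert (0 <= RInt (fun s => s * g s) a t) by (apply moment_nonneg; auto; apply Ig).
  assert (0 <= t * tail a g t) by (apply Rmult_le_pos; [lra | apply tail_nonneg; auto]).
  lra.
Qed.

Lemma green_monotone (a t : R) (f g : R -> R) :
  0 <= a <= t -> integrable_from a f -> integrable_from a g ->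
  (forall s, f s <= g s) -> green a f t <= green a g t.
Proof.
  intros H If Ig Hfg.
  assert (0 <= green a (fun s => g s + (-1) * f s) t).
  { apply green_nonneg; auto.
    - apply integrable_from_lin; auto.
    - intros s. specialize (Hfg s). lra. }
  rewrite green_lin in H0 by auto. lra.
Qed.

(** The kernel [min s t] is at most [t]. *)
Lemma green_le_integral (a t : R) (g : R -> R) :
  a <= t -> integrable_from a g -> (forall s, 0 <= g s) ->
  green a g t <= t * integral_from a g.
Proof.
  intros H [Cg _] Pg. unfold green, tail.
  assert (RInt (fun s => s * g s) a t <= t * RInt g a t).
  { rewrite <- (RInt_scal (V := R_CompleteNormedModule))
      by (apply ex_RInt_continuous_all, Cg).
    apply RInt_le; auto.
    - apply ex_RInt_continuous_all, continuous_id_mult, Cg.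
    - apply (ex_RInt_scal (V := R_NormedModule)), ex_RInt_continuous_all, Cg.
    - intros s Hs. apply Rmult_le_compat_r; [apply Pg | lra]. }
  lra.
Qed.

Lemma is_derive_RInt_continuous (a t : R) (g : R -> R) :
  (forall s, continuous g s) -> is_derive (fun t => RInt g a t) t (g t).
Proof.
  intros Cg. apply (is_derive_RInt g (fun t => RInt g a t) a); [| apply Cg].
  apply filter_forall. intros s.
  apply is_RInt_continuous, Cg.
Qed.

Lemma is_derive_tail (a t : R) (g : R -> R) :
  (forall s, continuous g s) -> is_derive (tail a g) t (- g t).
Proof.
  intros Cg. unfold tail.
  replace (- g t) with (0 - g t) by ring.
  apply (is_derive_minus (V := R_NormedModule) (fun _ : R => integral_from a g)).
  - apply (is_derive_const (V := R_NormedModule)).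
  - apply is_derive_RInt_continuous, Cg.
Qed.

(** The boundary terms [t * g t] of the two summands cancel. *)
Lemma is_derive_green (a t : R) (g : R -> R) :
  (forall s, continuous g s) -> is_derive (green a g) t (tail a g t).
Proof.
  intros Cg. unfold green.
  replace (tail a g t) with (t * g t + (1 * tail a g t + t * - g t)) by ring.
  apply (is_derive_plus (V := R_NormedModule)).
  - apply (is_derive_RInt_continuous a t (fun s => s * g s)), continuous_id_mult, Cg.
  - apply (is_derive_mult (fun s : R => s) (tail a g)).
    + apply (is_derive_id (K := R_AbsRing)).
    + apply is_derive_tail, Cg.
    + intros; apply Rmult_comm.
Qed.

(** The derivative [tail a g] decreases to [0].  Past a point [N] where it is
    below [eps / 2], the growth is at most [eps / 2 * (t - N)], while the value
    at [N] is absorbed by [eps / 2 * t] for large [t]. *)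
Lemma green_sublinear (a : R) (g : R -> R) :
  0 <= a -> integrable_from a g -> (forall s, 0 <= g s) ->
  forall eps, 0 < eps -> exists N, forall t, N <= t -> green a g t <= eps * t.
Proof.
  intros Ha Ig Pg eps Heps.
  destruct (tail_small a (eps / 2) g Ig ltac:(lra)) as [N [HN Htail]].
  exists (Rmax N (2 * green a g N / eps)). intros t Ht.
  assert (H1 := Rmax_l N (2 * green a g N / eps)).
  assert (H2 := Rmax_r N (2 * green a g N / eps)).
  assert (H3 : green a g N <= eps / 2 * t).
  { replace (green a g N) with (eps / 2 * (2 * green a g N / eps)) by (field; lra).
    apply Rmult_le_compat_l; lra. }
  destruct (MVT_gen (green a g) N t (tail a g)) as [s [Hs E]].
  - intros; apply is_derive_green, Ig.
  - intros s _. apply continuity_pt_filterlim.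
    apply (ex_derive_continuous (V := R_NormedModule)).
    eexists. apply is_derive_green, Ig.
  - rewrite Rmin_left, Rmax_right in Hs by lra.
    assert (tail a g s <= tail a g N).
    { unfold tail. assert (RInt g a N <= RInt g a s); [| lra].
      apply RInt_monotone; [apply Ig | auto | lra]. }
    assert (tail a g s * (t - N) <= eps / 2 * (t - N)) by (apply Rmult_le_compat_r; lra).
    assert (eps / 2 * (t - N) <= eps / 2 * t) by (apply Rmult_le_compat_l; lra).
    lra.
Qed.

(** * The power function on bounded positive arguments *)

Lemma signed_pow_pos (x lambda : R) : 0 < x -> signed_pow x lambda = Rpower x lambda.
Proof.
  intros Hx. unfold signed_pow. rewrite Rabs_pos_eq by lra.
  rewrite <- (Rpower_1 x Hx) at 2. rewrite <- Rpower_plus. f_equal. ring.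
Qed.

Lemma Rpower_increment (lambda M x y : R) :
  1 <= lambda -> 0 < x <= y -> y <= M ->
  Rpower y lambda - Rpower x lambda <= lambda * Rpower M (lambda - 1) * (y - x).
Proof.
  intros Hl Hxy HM.
  destruct (MVT_gen (fun z => Rpower z lambda) x y
              (fun z => lambda * Rpower z (lambda - 1))) as [z [Hz E]].
  - intros z Hz. rewrite Rmin_left in Hz by lra.
    apply is_derive_Reals, derivable_pt_lim_power. lra.
  - intros z Hz. rewrite Rmin_left in Hz by lra.
    apply derivable_continuous_pt. exists (lambda * Rpower z (lambda - 1)).
    apply derivable_pt_lim_power. lra.
  - rewrite Rmin_left, Rmax_right in Hz by lra. rewrite E.
    apply Rmult_le_compat_r; [lra |]. apply Rmult_le_compat_l; [lra |].
    apply Rle_Rpower_l; lra.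
Qed.

(** One-sided form of the Lipschitz estimate, ready to be multiplied by a
    weight and fed to the monotonicity of [green]. *)
Lemma Rpower_lipschitz (lambda M x y delta : R) :
  1 <= lambda -> 0 < x <= M -> 0 < y <= M -> Rabs (x - y) <= delta ->
  Rpower x lambda <= Rpower y lambda + lambda * Rpower M (lambda - 1) * delta.
Proof.
  intros Hl Hx Hy Hd. apply Rabs_le_between in Hd.
  assert (P : 0 <= lambda * Rpower M (lambda - 1)).
  { apply Rmult_le_pos; [lra | apply Rlt_le, exp_pos]. }
  destruct (Rle_lt_dec x y) as [H | H].
  - assert (Rpower x lambda <= Rpower y lambda) by (apply Rle_Rpower_l; lra).
    assert (0 <= lambda * Rpower M (lambda - 1) * delta) by (apply Rmult_le_pos; lra).
    lra.
  - assert (Rpower x lambda - Rpower y lambda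
            <= lambda * Rpower M (lambda - 1) * (x - y)) by (apply Rpower_increment; lra).
    assert (lambda * Rpower M (lambda - 1) * (x - y)
            <= lambda * Rpower M (lambda - 1) * delta) by (apply Rmult_le_compat_l; lra).
    lra.
Qed.

Lemma continuous_Rpower (f : R -> R) (lambda t : R) :
  continuous f t -> 0 < f t -> continuous (fun s => Rpower (f s) lambda) t.
Proof.
  intros Cf Pf. apply (continuous_comp f (fun z => Rpower z lambda)); [exact Cf |].
  apply (ex_derive_continuous (V := R_NormedModule)).
  exists (lambda * Rpower (f t) (lambda - 1)).
  apply is_derive_Reals, derivable_pt_lim_power, Pf.
Qed.

(** * Passing from the half-line to the real line *)

Lemma continuous_Rmax_const (a t : R) : continuous (Rmax a) t.
Proof.
  apply filterlim_locally. intros eps. exists eps. intros s Hs.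
  change (Rabs (s - t) < eps) in Hs. change (Rabs (Rmax a s - Rmax a t) < eps).
  apply Rabs_def2 in Hs. apply Rabs_def1; unfold Rmax;
    destruct (Rle_dec a s), (Rle_dec a t); lra.
Qed.

(** Precomposing with [Rmax a] extends a function constantly to the left of
    [a]; this turns relative continuity into continuity on the whole line, which
    the integration lemmas use. *)
Lemma continuous_clamp (a : R) (f : R -> R) :
  (forall t, half_line a t -> continue_in f (half_line a) t) ->
  forall t, continuous (fun s => f (Rmax a s)) t.
Proof.
  intros Cf t. apply filterlim_locally. intros eps.
  assert (Ha : half_line a (Rmax a t)) by apply Rmax_l.
  destruct (Cf _ Ha eps (cond_pos eps)) as [alp [Halp H]].
  assert (Cm := continuous_Rmax_const a t).
  apply filterlim_locally with (eps := mkposreal alp Halp) in Cm.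
  revert Cm. apply filter_imp. intros s Hs.
  change (Rabs (Rmax a s - Rmax a t) < alp) in Hs.
  change (Rabs (f (Rmax a s) - f (Rmax a t)) < eps).
  destruct (Req_dec (Rmax a t) (Rmax a s)) as [E | E].
  - rewrite E, Rminus_diag, Rabs_R0. apply cond_pos.
  - apply (H (Rmax a s)). split; [| exact Hs].
    split; [apply Rmax_l | exact E].
Qed.

(** Proper integrals of a nonnegative function increase to the improper one. *)
Lemma RInt_le_RInt_gen (a : R) (f g : R -> R) :
  (forall t, continuous g t) -> (forall t, 0 <= g t) ->
  (forall t, a <= t -> f t = g t) ->
  ex_RInt_gen f (at_point a) (Rbar_locally p_infty) ->
  forall t, a <= t -> RInt g a t <= RInt_gen f (at_point a) (Rbar_locally p_infty).
Proof.
  intros Cg Pg Efg Hex t Ht.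
  apply (RInt_gen_correct (V := R_CompleteNormedModule)) in Hex.
  set (I := RInt_gen f _ _) in *.
  apply le_epsilon. intros eps Heps.
  destruct (Hex (ball I (mkposreal eps Heps)) (locally_ball _ _)) as [P Q HP [M HM] H].
  set (b := Rmax t (M + 1)).
  assert (Hb1 := Rmax_l t (M + 1)). assert (Hb2 := Rmax_r t (M + 1)). fold b in Hb1, Hb2.
  destruct (H a b HP ltac:(apply HM; lra)) as [y [Hy By]]. simpl in Hy.
  change (Rabs (y - I) < eps) in By. apply Rabs_def2 in By.
  assert (E : RInt g a b = y).
  { apply is_RInt_unique. apply (is_RInt_ext f); [| exact Hy].
    intros s Hs. rewrite Rmin_left in Hs by lra. apply Efg; lra. }
  assert (RInt g a t <= RInt g a b) by (apply RInt_monotone; auto).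
  lra.
Qed.

Lemma is_derive_D_in (f df : R -> R) (D : R -> Prop) (t : R) :
  is_derive f t (df t) -> D_in f df D t.
Proof.
  intros H. apply is_derive_Reals, derivable_pt_lim_D_in in H.
  apply (limit1_imp _ (D_x no_cond t)); [| exact H].
  intros s [_ Hs]. split; [exact I | exact Hs].
Qed.

(** * The equation for the slope *)

(** Contraction on [c + k / t <= v <= M], with both sides and the operator
    extended constantly to the left of [a].  Dividing [green] by [t] gives the
    kernel [min s t / t <= 1], which is why only the integral of [w] enters.
    The lower bound [c + k / t] is positive, so [v] never reaches the point [0],
    where the convention [Rpower 0 lambda = 1] would break continuity. *)
Lemma slope_equation_solution (a lambda k c M I : R) (w : R -> R) :
  0 < a -> 1 <= lambda -> 0 < k -> 0 <= c ->
  (forall t, continuous w t) -> (forall t, 0 <= w t) ->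
  (forall t, a <= t -> RInt w a t <= I) ->
  lambda * Rpower M (lambda - 1) * I < 1 ->
  c + k / a + Rpower M lambda * I <= M ->
  exists v : R -> R,
    (forall t, continuous v t) /\ (forall t, 0 < v t <= M) /\
    integrable_from a (fun s => w s * Rpower (v s) lambda) /\
    forall t, a <= t ->
      t * v t = k + c * t + green a (fun s => w s * Rpower (v s) lambda) t.
Proof.
  intros Ha Hl Hk Hc Cw Pw HI Hkappa HM.
  destruct (integrable_from_bounded a I w Cw Pw HI) as [Iw Hw].
  assert (PI : 0 <= I).
  { specialize (HI a (Rle_refl a)). rewrite RInt_point in HI. exact HI. }
  assert (Hm : forall t, a <= Rmax a t) by (intros; apply Rmax_l).
  assert (Hka : forall t, 0 < k / Rmax a t <= k / a).
  { intros t. specialize (Hm t). split.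
    - apply Rdiv_lt_0_compat; lra.
    - apply Rmult_le_compat_l; [lra | apply Rinv_le_contravar; lra]. }
  assert (PMI : 0 <= Rpower M lambda * I)
    by (apply Rmult_le_pos; [apply Rlt_le, exp_pos | lra]).
  assert (PK : 0 <= lambda * Rpower M (lambda - 1)).
  { apply Rmult_le_pos; [lra | apply Rlt_le, exp_pos]. }
  set (lo := fun t => c + k / Rmax a t).
  set (src := fun (v : R -> R) s => w s * Rpower (v s) lambda).
  assert (Pmax : forall t, 0 < Rmax a t) by (intros t; specialize (Hm t); lra).
  assert (Cquot : forall u : R -> R, (forall t, continuous u t) ->
            forall t, continuous (fun s => c + u (Rmax a s) / Rmax a s) t).
  { intros u Cu t.
    apply (continuous_comp (Rmax a) (fun z => c + u z / z)); [apply continuous_Rmax_const |].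
    apply (continuous_plus (V := R_NormedModule) (fun _ : R => c)); [apply continuous_const |].
    apply (continuous_mult u (fun z => / z)); [apply Cu |].
    apply continuous_Rinv. specialize (Pmax t). lra. }
  assert (Hsrc : forall v, (forall t, continuous v t) /\
                   (forall t, lo t <= v t <= M) ->
            (forall t, 0 < v t <= M) /\ (forall s, 0 <= src v s) /\
            integrable_from a (src v) /\
            integral_from a (src v) <= Rpower M lambda * I).
  { intros v [Cv Bv].
    assert (Bv' : forall t, 0 < v t <= M).
    { intros t. specialize (Bv t). specialize (Hka t). unfold lo in Bv. lra. }
    assert (Ps : forall s, 0 <= src v s).
    { intros s. apply Rmult_le_pos; [apply Pw | apply Rlt_le, exp_pos]. }
    split; [exact Bv' |]. split; [exact Ps |].
    assert (Cs : forall t, continuous (src v) t).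
    { intros t. apply (continuous_mult w (fun s => Rpower (v s) lambda)); [apply Cw |].
      apply continuous_Rpower; [apply Cv | apply Bv']. }
    apply integrable_from_bounded; auto.
    intros t Ht.
    apply Rle_trans with (Rpower M lambda * RInt w a t).
    - rewrite <- (RInt_scal (V := R_CompleteNormedModule))
        by (apply ex_RInt_continuous_all, Cw).
      apply RInt_le; auto.
      + apply ex_RInt_continuous_all, Cs.
      + apply (ex_RInt_scal (V := R_NormedModule)), ex_RInt_continuous_all, Cw.
      + intros s _. unfold src. change (scal ?x ?y) with (x * y).
        rewrite Rmult_comm. apply Rmult_le_compat_r; [apply Pw |].
        specialize (Bv' s). apply Rle_Rpower_l; lra.
    - apply Rmult_le_compat_l; [apply Rlt_le, exp_pos | apply HI, Ht]. }
  destruct (contraction_fixed_point lo (fun _ => M) M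
              (lambda * Rpower M (lambda - 1) * I)
              (fun v t => c + (k + green a (src v) (Rmax a t)) / Rmax a t))
    as [v [[Cv Bv] Hv]].
  - apply (Cquot (fun _ => k)). intros; apply continuous_const.
  - intros t. specialize (Hka t). unfold lo. lra.
  - split; [apply Rmult_le_pos; lra | exact Hkappa].
  - intros v Hv. destruct (Hsrc v Hv) as [_ [Ps [Is Js]]]. split.
    + apply (Cquot (fun z => k + green a (src v) z)). intros t.
      apply (continuous_plus (V := R_NormedModule) (fun _ : R => k)); [apply continuous_const |].
      apply (ex_derive_continuous (V := R_NormedModule)).
      eexists. apply is_derive_green, Is.
    + intros t. specialize (Hm t). specialize (Hka t). specialize (Pmax t).
      assert (G0 := green_nonneg a (Rmax a t) (src v) ltac:(lra) Is Ps).
      assert (G1 := green_le_integral a (Rmax a t) (src v) Hm Is Ps).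
      assert (0 <= green a (src v) (Rmax a t) / Rmax a t) by (apply Rdiv_le_0_compat; lra).
      assert (green a (src v) (Rmax a t) / Rmax a t <= integral_from a (src v)).
      { apply Rle_div_l; lra. }
      unfold lo. rewrite Rdiv_plus_distr. lra.
  (* Half of the contraction estimate: [src f <= src g + m * w] pointwise, then
       [green] is monotone and linear; exchanging [f] and [g] gives the rest. *)
  - assert (Half : forall f g delta,
      (forall t, continuous f t) /\ (forall t, lo t <= f t <= M) ->
      (forall t, continuous g t) /\ (forall t, lo t <= g t <= M) -> 0 <= delta ->
      (forall t, Rabs (f t - g t) <= delta) ->
      forall t, green a (src f) (Rmax a t) / Rmax a t
        <= green a (src g) (Rmax a t) / Rmax a t
           + lambda * Rpower M (lambda - 1) * I * delta).
    { intros f g delta Hf Hg Hdelta Hfg t.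
      destruct (Hsrc f Hf) as [Bf [_ [If _]]], (Hsrc g Hg) as [Bg [_ [Ig _]]].
      specialize (Hm t). specialize (Pmax t).
      set (m := lambda * Rpower M (lambda - 1) * delta).
      assert (Pm : 0 <= m) by (apply Rmult_le_pos; lra).
      assert (L := green_lin a m (Rmax a t) (src g) w Ig Iw).
      assert (W := green_le_integral a (Rmax a t) w Hm Iw Pw).
      assert (G : green a (src f) (Rmax a t)
                  <= green a (fun s => src g s + m * w s) (Rmax a t)).
      { apply green_monotone; [lra | exact If | apply integrable_from_lin; auto |].
        intros s. unfold src.
        rewrite (Rmult_comm m), <- Rmult_plus_distr_l.
        apply Rmult_le_compat_l; [apply Pw |].
        apply Rpower_lipschitz; auto. }
      assert (W2 : m * green a w (Rmax a t) <= m * (Rmax a t * I)).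
      { apply Rmult_le_compat_l; [exact Pm |].
        apply Rle_trans with (1 := W). apply Rmult_le_compat_l; lra. }
      apply Rle_div_l; [lra |].
      replace ((green a (src g) (Rmax a t) / Rmax a t
                + lambda * Rpower M (lambda - 1) * I * delta) * Rmax a t)
        with (green a (src g) (Rmax a t) + m * (Rmax a t * I))
        by (unfold m; field; lra).
      lra. }
    intros f g delta Hf Hg Hdelta Hfg t.
    assert (H1 := Half f g delta Hf Hg Hdelta Hfg t).
    assert (H2 : forall t, Rabs (g t - f t) <= delta)
      by (intros s; rewrite Rabs_minus_sym; apply Hfg).
    apply (fun H => Half g f delta Hg Hf Hdelta H t) in H2.
    apply Rabs_le. rewrite !Rdiv_plus_distr. lra.
  - exists v. destruct (Hsrc v (conj Cv Bv)) as [Bv' [_ [Is _]]].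
    split; [exact Cv |]. split; [exact Bv' |]. split; [exact Is |].
    intros t Ht. rewrite <- (Hv t) at 1. rewrite Rmax_right by exact Ht.
    unfold src. field. lra.
Qed.

(** * The solution *)

Theorem theorem9 (t0 lambda c d : R) (q : R -> R)
  (ht0 : 1 <= t0) (hlambda : 1 <= lambda) (hc : 0 <= c) (hd : 0 < d)
  (hq_nonneg : forall t : R, half_line t0 t -> 0 <= q t)
  (hq_cont : forall t : R, half_line t0 t -> continue_in q (half_line t0) t)
  (hq_zeros : isolated_zeros q (half_line t0))
  (hint : ex_RInt_gen (fun t : R => signed_pow t lambda * q t)
            (at_point t0) (Rbar_locally p_infty))
  (hsmall : Rmax (lambda * Rpower (c + d) (lambda - 1))
                 (signed_pow (c + d) lambda / d)
            * RInt_gen (fun t : R => signed_pow t lambda * q t)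
                (at_point t0) (Rbar_locally p_infty) < 1) :
  exists x x1 x2 : R -> R,
    is_solution q lambda t0 x x1 x2 /\
    (forall t : R, t0 < t ->
       c - d <= x1 t /\ x1 t < x t / t /\ x t / t <= c + d) /\
    is_domin (Rbar_locally p_infty) (fun t : R => t) (fun t : R => x t - c * t).
Proof.
  set (J := RInt_gen _ _ _) in hsmall.
  pose (w := fun t => Rpower (Rmax t0 t) lambda * q (Rmax t0 t)).
  assert (Hm : forall t, t0 <= Rmax t0 t) by (intros; apply Rmax_l).
  assert (Cw : forall t, continuous w t).
  { intros t. apply (continuous_mult (fun s => Rpower (Rmax t0 s) lambda)
                       (fun s => q (Rmax t0 s))).
    - apply continuous_Rpower; [apply continuous_Rmax_const |].
      specialize (Hm t). lra.
    - apply continuous_clamp, hq_cont. }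
  assert (Pw : forall t, 0 <= w t).
  { intros t. apply Rmult_le_pos; [apply Rlt_le, exp_pos | apply hq_nonneg, Hm]. }
  assert (HJ : forall t, t0 <= t -> RInt w t0 t <= J).
  { apply RInt_le_RInt_gen; auto. intros t Ht. unfold w.
    rewrite Rmax_right by exact Ht. rewrite signed_pow_pos by lra. reflexivity. }
  assert (PJ : 0 <= J).
  { specialize (HJ t0 (Rle_refl t0)). rewrite RInt_point in HJ. exact HJ. }
  rewrite (signed_pow_pos (c + d)) in hsmall by lra.
  assert (H1 : lambda * Rpower (c + d) (lambda - 1) * J < 1).
  { apply Rle_lt_trans with (2 := hsmall).
    apply Rmult_le_compat_r; [exact PJ | apply Rmax_l]. }
  assert (H2 : Rpower (c + d) lambda * J < d).
  { apply (Rmult_lt_reg_r (/ d)); [apply Rinv_0_lt_compat, hd |].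
    rewrite Rinv_r by lra. apply Rle_lt_trans with (2 := hsmall).
    replace (Rpower (c + d) lambda * J * / d) with (Rpower (c + d) lambda / d * J)
      by (unfold Rdiv; ring).
    apply Rmult_le_compat_r; [exact PJ | apply Rmax_r]. }
  (* Chosen to make the upper bound for the slope exactly [c + d]. *)
  pose (k := t0 * (d - Rpower (c + d) lambda * J)).
  assert (Hk : 0 < k) by (apply Rmult_lt_0_compat; lra).
  destruct (slope_equation_solution t0 lambda k c (c + d) J w)
    as [v [Cv [Bv [Ig Hv]]]]; auto; try lra.
  { unfold k. right. field. lra. }
  set (g := fun s => w s * Rpower (v s) lambda) in *.
  assert (Pg : forall s, 0 <= g s).
  { intros s. apply Rmult_le_pos; [apply Pw | apply Rlt_le, exp_pos]. }
  destruct Ig as [Cg Lg]. assert (Ig := conj Cg Lg : integrable_from t0 g).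
  exists (fun t => k + c * t + green t0 g t), (fun t => c + tail t0 g t), (fun t => - g t).
  split; [| split].
  - intros t Ht. split; [| split].
    + apply is_derive_D_in.
      apply (is_derive_plus (V := R_NormedModule) (fun t => k + c * t));
        [auto_derive; [exact I | ring] | apply is_derive_green, Cg].
    + apply is_derive_D_in. rewrite <- (Rplus_0_l (- g t)).
      apply (is_derive_plus (V := R_NormedModule) (fun _ : R => c));
        [apply (is_derive_const (V := R_NormedModule)) | apply is_derive_tail, Cg].
    + unfold half_line in Ht. rewrite <- Hv by exact Ht.
      rewrite signed_pow_pos by (apply Rmult_lt_0_compat; [lra | apply Bv]).
      rewrite <- Rpower_mult_distr by (try apply Bv; lra).
      unfold g, w. rewrite Rmax_right by exact Ht. ring.
  - intros t Ht. assert (T := tail_nonneg t0 t g Ig Pg). split; [lra |]. split.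
    + assert (Mt := moment_nonneg t0 t g ltac:(lra) Cg Pg).
      apply Rlt_div_r; [lra |]. unfold green. lra.
    + rewrite <- Hv by lra. apply Rle_div_l; [lra |].
      rewrite Rmult_comm. apply Rmult_le_compat_r; [lra | apply Bv].
  - intros [eps Heps].
    destruct (green_sublinear t0 g ltac:(lra) Ig Pg (eps / 2) ltac:(lra)) as [N HN].
    exists (Rmax (Rmax t0 N) (2 * k / eps)). intros t Ht.
    assert (A1 := Rmax_l (Rmax t0 N) (2 * k / eps)).
    assert (A2 := Rmax_r (Rmax t0 N) (2 * k / eps)).
    assert (A3 := Rmax_l t0 N). assert (A4 := Rmax_r t0 N).
    specialize (HN t ltac:(lra)).
    assert (G := green_nonneg t0 t g ltac:(lra) Ig Pg).
    assert (K : k <= eps / 2 * t).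
    { replace k with (eps / 2 * (2 * k / eps)) by (field; lra).
      apply Rmult_le_compat_l; lra. }
    change (Rabs (k + c * t + green t0 g t - c * t) <= eps * Rabs t).
    rewrite !Rabs_pos_eq by lra. lra.
Qed.
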